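(* Let $X,Y,Z,W$ be locally convex Hausdorff topological vector spaces, $K\subset Y$ a proper closed convex cone with $\operatorname{int}K\ne\emptyset$, $P\subset W$ and $S\subset Z$ nonempty convex cones, $F\colon X\to Y^\infty$, $\kappa\colon W\to Y^\infty$, $H\colon X\to W^\infty$, $G\colon X\to Z^\infty$ proper mappings, $C\subset X$ nonempty, $A=C\cap G^{-1}(-S)$, and assume $A\cap\operatorname{dom}F\cap H^{-1}(\operatorname{dom}\kappa)\neq\emptyset$. Assume that $F$ is $K$-convex, $H$ is $P$-convex, $G$ is $S$-convex, $\kappa$ is $K$-convex and $(P,K)$-nondecreasing, and $C$ is convex. Let $$Z_0^1=\operatorname{lin}\big[\{(H(x),G(x)):x\in C\cap\operatorname{dom}H\cap\operatorname{dom}G\}+(-\operatorname{dom}\kappa)\times S\big]\subset W\times Z,$$ and assume that for every $L\in\mathcal L(X,Y)$ there exist $y_L\in Y$ and a neighborhood $V_L$ of $(0_W,0_Z)$ such that for every $(w,z)\in V_L\cap Z_0^1$ there is $x\in C$ with $G(x)+z\in-S$ and $F(x)+\kappa(H(x)+w)-L(x)\leqq_Ky_L$. Then stable strong duality holds for the pairs $(\mathrm{CCVP})-(\mathrm{CCVD}^1)$ and $(\mathrm{CCVP})-(\mathrm{CCVD}^1_\ell)$; that is, for every $L\in\mathcal L(X,Y)$, $$\operatorname{WInf}\{F(x)+(\kappa\circ H)(x)-L(x):x\in A\}=\operatorname{WMax}D_L=\operatorname{WMax}D_L^+,$$ where $$D_L=\bigcup_{T_1\in\operatorname{dom}\kappa^*,\;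 T_2\in\mathcal L_+^w(S,K)}\operatorname{WInf}\{F(x)-L(x)+(T_1\circ H)(x)+(T_2\circ G)(x)+\kappa(w)-T_1(w)+T_2(s):x\in C,\,w\in W,\,s\in S\},$$ $$D_L^+=\bigcup_{T_1\in\operatorname{dom}\kappa^*\cap\mathcal L_+(P,K),\; T_2\in\mathcal L_+(S,K)}\operatorname{WInf}\{F(x)-L(x)+(T_1\circ H)(x)+(T_2\circ G)(x)+\kappa(w)-T_1(w):x\in C,\,w\in W\}.$$
   Context: Ordering: $K$ proper means $K\neq Y$. $y_1\leqq_Ky_2$ iff $y_1-y_2\in-K$; $y_1<_K y_2$ iff $y_1-y_2\in-\operatorname{int}K$. $Y^\infty=Y\cup\{+\infty_Y\}$, $Y^\bullet=Y\cup\{\pm\infty_Y\}$, with $-\infty_Y<_Ky<_K+\infty_Y$ for $y\in Y$, $-\infty_Y<_K+\infty_Y$, $-(\pm\infty_Y)=\mp\infty_Y$, $y+(+\infty_Y)=+\infty_Y$ for $y\in Y^\infty$; $y\leqq_K+\infty_Y$ for all $y\in Y^\infty$ and $+\infty_Y\not\leqq_Ky$ for $y\in Y$. Similarly $W^\infty=W\cup\{+\infty_W\}$, $Z^\infty=Z\cup\{+\infty_Z\}$. For $M\subset Y^\bullet$: $\operatorname{WSup}M$ is the set of $\bar v\in Y^\bullet$ such that $\bar v\not<_Kv$ for all $v\in M$ and for every $\tilde v\in Y^\bullet$ with $\tilde v<_K\bar v$ there is $v\in M$ with $\tilde v<_Kv$; $\operatorname{WInf}M=-\operatorname{WSup}(-M)$;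 $\operatorname{WMax}M=M\cap\operatorname{WSup}M$. $\operatorname{dom}$ is the set of points where a mapping is not $+\infty$; a mapping into $Y^\infty$, $W^\infty$, $Z^\infty$ is proper if its domain is nonempty. A mapping $E$ is $Q$-convex ($Q$ a convex cone in the target space) if $\{(x,y):x\in\operatorname{dom}E,\ y\in E(x)+Q\}$ is convex. $\kappa$ is $(P,K)$-nondecreasing if $w_1-w_2\in-P$ implies $\kappa(w_1)\leqq_K\kappa(w_2)$. $\kappa(+\infty_W)=+\infty_Y$. $\mathcal L(\cdot,\cdot)$ denotes continuous linear maps. For $T\in\mathcal L(Z,Y)$, $(T\circ G)(x)=T(G(x))$ if $G(x)\in Z$ and $+\infty_Y$ otherwise; likewise $T\circ H$. $\kappa^*(T)=\operatorname{WSup}\{T(w)-\kappa(w):w\in W\}$, $\operatorname{dom}\kappa^*=\{T\in\mathcal L(W,Y):\kappa^*(T)\neq\{+\infty_Y\}\}$. $\mathcal L_+(S,K)=\{T\in\mathcal L(Z,Y):T(S)\subset K\}$, $\mathcal L_+^w(S,K)=\{T\in\mathcal L(Z,Y):T(S)\cap(-\operatorname{int}K)=\emptyset\}$, $\mathcal L_+(P,K)$ analogously. $\operatorname{lin}$ is the linear hull. $(\mathrm{CCVP})$ is the problem $\operatorname{WInf}\{F(x)+(\kappa\circ H)(x):x\in C,\ G(x)\in-S\}$; $(\mathrm{CCVD}^1)$ and $(\mathrm{CCVD}^1_\ell)$ are its Lagrange and loose Lagrange duals, obtained from $D_L$ and $D_L^+$ with $L=0$.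
   Formalization: The formal theorem additionally assumes that dom κ* is nonempty; without this the claim is false (e.g. κ a discontinuous linear functional, H the identity, F = G = 0, P = S = {0}), since then D_L and D_L^+ are empty while the primal WInf is not. *)

(* Defs.v *)
From HB Require Import structures.
From mathcomp Require Import all_boot all_order all_algebra.
From mathcomp Require Import all_classical all_reals all_analysis.

Set Implicit Arguments.
Unset Strict Implicit.
Unset Printing Implicit Defensive.

Import Order.TTheory GRing.Theory Num.Theory.
Import numFieldNormedType.Exports.

Local Open Scope classical_set_scope.
Local Open Scope ring_scope.

(* [uext V] is V with a greatest element adjoined; [bext V] is V with both a
   greatest and a least element adjoined. Mappings take values in [uext], while
   weak suprema and infima live in [bext]. *)
Inductive uext (V : Type) : Type := UFin of V | UInf.
Arguments UFin {V} v.
Arguments UInf {V}.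

Inductive bext (V : Type) : Type := BFin of V | BPInf | BNInf.
Arguments BFin {V} v.
Arguments BPInf {V}.
Arguments BNInf {V}.

Declare Scope uext_scope.
Delimit Scope uext_scope with U.
Notation "v %:fin" := (UFin v) (at level 1, left associativity, format "v %:fin").

Definition u2b (V : Type) (u : uext V) : bext V :=
  if u is v%:fin then BFin v else BPInf.

Definition udom (T V : Type) (f : T -> uext V) : set T := [set x | f x <> UInf].

Definition uproper (T V : Type) (f : T -> uext V) : Prop := udom f !=set0.

(* Value of f : V -> uext U at a point of [uext V], with f (+oo) = +oo. *)
Definition uapp (V U : Type) (f : V -> uext U) (v : uext V) : uext U :=
  if v is a%:fin then f a else UInf.

Section ExtendedOperations.
Variable V : zmodType.

Definition uadd (u v : uext V) : uext V :=
  match u, v with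
  | a%:fin, b%:fin => (a + b)%:fin
  | _, _ => UInf
  end.

Definition bopp (v : bext V) : bext V :=
  match v with
  | BFin a => BFin (- a)
  | BPInf => BNInf
  | BNInf => BPInf
  end.

Definition btranslate (a : V) (v : bext V) : bext V :=
  if v is BFin b then BFin (a + b) else v.

Definition setN (A : set V) : set V := [set - a | a in A].

End ExtendedOperations.

Notation "u + v" := (uadd u v) : uext_scope.

Section Cones.
Variables (R : realType) (V : lmodType R).

(* Stability under positive scalars only: 0 is not required to belong to Q. *)
Definition cone (Q : set V) : Prop :=
  forall (t : R) (v : V), 0 < t -> Q v -> Q (t *: v).

Definition convex_cone (Q : set V) : Prop := cone Q /\ convex_set Q.

Definition lin (A : set V) : set V :=
  smallest (fun U : set V => submod_closed (mem U)) A.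

(* Convexity of a mapping with respect to a cone, through its epigraph. *)
Definition cone_convex (X : lmodType R) (Q : set V) (E : X -> uext V) : Prop :=
  convex_set [set p : X * V |
    exists2 v : V, E p.1 = v%:fin & exists2 q, Q q & p.2 = v + q].

End Cones.

Section Ordering.
Variables (R : realType) (Y : tvsType R) (K : set Y).

Definition cle (u v : uext Y) : Prop :=
  match u, v with
  | _, UInf => True
  | a%:fin, b%:fin => setN K (a - b)
  | UInf, _%:fin => False
  end.

Definition clt (u v : bext Y) : Prop :=
  match u, v with
  | BFin a, BFin b => setN (interior K) (a - b)
  | BNInf, BFin _ | BNInf, BPInf | BFin _, BPInf => True
  | _, _ => False
  end.

Definition WSup (M : set (bext Y)) : set (bext Y) :=
  [set v | (forall m, M m -> ~ clt v m) /\
           (forall u, clt u v -> exists2 m, M m & clt u m)].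

Definition WInf (M : set (bext Y)) : set (bext Y) :=
  [set bopp v | v in WSup [set bopp m | m in M]].

Definition WMax (M : set (bext Y)) : set (bext Y) := M `&` WSup M.

Definition nondecreasing_cone (W : tvsType R) (P : set W) (kappa : W -> uext Y)
    : Prop :=
  forall w1 w2, setN P (w1 - w2) -> cle (kappa w1) (kappa w2).

Definition conjugate (W : tvsType R) (kappa : W -> uext Y)
    (T : {linear W -> Y}) : set (bext Y) :=
  WSup [set btranslate (T w) (bopp (u2b (kappa w))) | w in [set: W]].

(* May be empty (e.g. for kappa a discontinuous linear form); then the duals
   below are empty, and so is their WMax, whereas WInf is never empty. *)
Definition dom_conjugate (W : tvsType R) (kappa : W -> uext Y)
    : set {linear W -> Y} :=
  [set T : {linear W -> Y} | continuous T /\ conjugate kappa T <> [set BPInf]].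

Definition Lplus (Z : tvsType R) (S : set Z) : set {linear Z -> Y} :=
  [set T : {linear Z -> Y} | continuous T /\ T @` S `<=` K].

Definition Lplusw (Z : tvsType R) (S : set Z) : set {linear Z -> Y} :=
  [set T : {linear Z -> Y} | continuous T /\ T @` S `&` setN (interior K) = set0].

End Ordering.

Section CompositeProblem.
Variables (R : realType) (X Y Z W : tvsType R).
Variables (K : set Y) (P : set W) (S : set Z) (C : set X).
Variables (F : X -> uext Y) (kappa : W -> uext Y).
Variables (H : X -> uext W) (G : X -> uext Z).

Definition feasible : set X := C `&` G @^-1` (UFin @` setN S).

Definition Z01 : set (W * Z) :=
  lin [set a + b |
        a in [set p : W * Z | exists2 x, C x & H x = p.1%:fin /\ G x = p.2%:fin]
      & b in setN (udom kappa) `*` S].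

Definition primal_values (L : {linear X -> Y}) : set (bext Y) :=
  [set u2b (F x + uapp kappa (H x) + (- L x)%:fin)%U | x in feasible].

Definition lagrangian (L : {linear X -> Y}) (T1 : {linear W -> Y})
    (T2 : {linear Z -> Y}) (x : X) (w : W) : uext Y :=
  (F x + (- L x)%:fin + uapp (fun h => (T1 h)%:fin) (H x)
   + uapp (fun g => (T2 g)%:fin) (G x) + kappa w + (- T1 w)%:fin)%U.

Definition DL (L : {linear X -> Y}) : set (bext Y) :=
  \bigcup_(T1 in dom_conjugate K kappa) \bigcup_(T2 in Lplusw K S)
    WInf K [set m | exists x w s, [/\ C x, S s &
      m = u2b (lagrangian L T1 T2 x w + (T2 s)%:fin)%U]].

Definition DLplus (L : {linear X -> Y}) : set (bext Y) :=
  \bigcup_(T1 in dom_conjugate K kappa `&` Lplus K P)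
  \bigcup_(T2 in Lplus K S)
    WInf K [set m | exists x w, C x /\ m = u2b (lagrangian L T1 T2 x w)].

End CompositeProblem.

(* Main.v *)
(* Weak duality makes the dual value sets lie below the primal values, so both
   equalities follow once every finite y0 in WInf of the primal values is
   attained by one pair of multipliers. For this, perturb the two constraints
   by (w, z) and take the convex epigraph E in W x Z x Y of the perturbed
   problem. The point (0, 0, y0) is not in E, while by the regularity condition
   E contains (w, z, y1) for all (w, z) in Z_0^1 near 0. A hyperplane
   (w', z', y') separates (0, 0, y0) from E; y' is positive on the interior of
   K, and T1 = - w' k / y'(k), T2 = - z' k / y'(k) with k in int K are the
   multipliers. When the primal values are unbounded below, a multiplier T1
   that is positive on P comes from scalarizing an arbitrary element of the
   domain of the conjugate of kappa.
   The separating functional is built by Zorn's lemma: a maximal convex cone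
   missing 0 orders the space totally, and an order unit e gives
   f(x) = sup {t | x - t e > 0}. *)
Require Import Defs.
From HB Require Import structures.
From mathcomp Require Import all_boot all_order all_algebra.
From mathcomp Require Import all_classical all_reals all_analysis.
From mathcomp Require Import ring lra.
Import Order.TTheory GRing.Theory Num.Theory.
Import numFieldNormedType.Exports.
Local Open Scope classical_set_scope.
Local Open Scope ring_scope.
Set Implicit Arguments.
Unset Strict Implicit.
Unset Printing Implicit Defensive.

(** * Identities in modules *)

(** A named alias, so that the ring structure below is attached to it and not to every pair type. *)
Definition square_zero (R : comNzRingType) (V : lmodType R) : Type := (R * V)%type.

Section SquareZeroExtension.
Variables (R : comNzRingType) (V : lmodType R).
Local Notation E := (square_zero V).

HB.instance Definition _ := GRing.Zmodule.on E.

Definition sz_mul (x y : E) : E := (x.1 * y.1, x.1 *: y.2 + y.1 *: x.2).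

Let sz_mulA : associative sz_mul.
Proof.
move=> [a u] [b v] [c w]; rewrite /sz_mul /=; congr (_, _); first by ring.
rewrite !scalerDr !scalerA addrA; congr (_ + _ *: _ + _ *: _); ring.
Qed.

Let sz_mulC : commutative sz_mul.
Proof. by move=> x y; rewrite /sz_mul mulrC addrC. Qed.

Let sz_mul1 : left_id ((1, 0) : E) sz_mul.
Proof. by move=> [a u]; rewrite /sz_mul /= mul1r scale1r scaler0 addr0. Qed.

Let sz_mulDl : left_distributive sz_mul +%R.
Proof.
move=> [a u] [b v] [c w]; rewrite /sz_mul /=; congr (_, _); first by rewrite mulrDl.
by rewrite scalerDl scalerDr addrACA.
Qed.

Let sz_nontrivial : ((1, 0) : E) != 0.
Proof. by rewrite -pair_eqE negb_and oner_neq0. Qed.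

HB.instance Definition _ := GRing.Zmodule_isComNzRing.Build E
  sz_mulA sz_mulC sz_mul1 sz_mulDl sz_nontrivial.

Definition sz_scalar (a : R) : E := (a, 0).
Definition sz_vector (v : V) : E := (0, v).

Let sz_scalar_additive : zmod_morphism sz_scalar.
Proof. by move=> a b; rewrite /sz_scalar; congr (_, _); rewrite /= subr0. Qed.

Let sz_scalar_multiplicative : monoid_morphism sz_scalar.
Proof.
split=> // a b; rewrite /sz_scalar [RHS]/GRing.mul /= /sz_mul /=.
by rewrite !scaler0 addr0.
Qed.

HB.instance Definition _ := GRing.isZmodMorphism.Build R E sz_scalar sz_scalar_additive.
HB.instance Definition _ :=
  GRing.isMonoidMorphism.Build R E sz_scalar sz_scalar_multiplicative.

Lemma sz_vectorD (u v : V) : sz_vector (u + v) = sz_vector u + sz_vector v.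
Proof. by rewrite /sz_vector; congr (_, _); rewrite /= addr0. Qed.

Lemma sz_vectorN (v : V) : sz_vector (- v) = - sz_vector v.
Proof. by rewrite /sz_vector; congr (_, _); rewrite /= oppr0. Qed.

Lemma sz_vectorZ (a : R) (v : V) : sz_vector (a *: v) = sz_scalar a * sz_vector v.
Proof.
rewrite /sz_vector [RHS]/GRing.mul /= /sz_mul /= mulr0; congr (_, _).
by rewrite scale0r addr0.
Qed.

Lemma sz_vector0 : sz_vector 0 = 0. Proof. by []. Qed.

Lemma sz_vector_inj : injective sz_vector.
Proof. by move=> u v []. Qed.

End SquareZeroExtension.

(* An identity of a module over a commutative ring is an identity of its
   square-zero extension, where the [ring] tactic applies. *)
Ltac lmod := apply: sz_vector_inj;
  rewrite ?(sz_vectorD, sz_vectorN, sz_vectorZ, sz_vector0); ring.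

(** * Linear forms from ordering cones *)

Lemma bundle_linear (R : realType) (U V : lmodType R) (g : U -> V) :
  linear g -> exists f : {linear U -> V}, f =1 g.
Proof.
move=> lin_g; pose Lg := GRing.isLinear.Build R U V *:%R g lin_g.
by pose f : {linear U -> V} := HB.pack g Lg; exists f.
Qed.

Lemma le_from_below (R : realFieldType) (x y : R) :
  (forall z, z < x -> z <= y) -> x <= y.
Proof.
move=> zy; rewrite leNgt; apply/negP => yx.
by have := zy ((x + y) / 2); lra.
Qed.

Section ConeFunctional.
Variables (R : realType) (V : lmodType R).
Implicit Types (M D : set V) (x y e v : V).

(** Read [M x] as x > 0: these are the strictly positive vectors of a compatible partial order. *)
Definition blunt_cone M : Prop :=
  [/\ cone M, (forall x y, M x -> M y -> M (x + y)) & ~ M 0].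

(** A maximal blunt cone above [D] is total: if it missed both [v] and [- v], adjoining the positive
    multiples of [v] would enlarge it. *)
Lemma blunt_cone_total D : blunt_cone D ->
  exists M, [/\ blunt_cone M, D `<=` M & forall v, v <> 0 -> M v \/ M (- v)].
Proof.
(* Zorn runs over the sets added to [D], so that the union of the empty chain causes no trouble. *)
move=> bD; pose Q : set (set V) := [set A | blunt_cone (D `|` A)].
have [F FQ totF|A [QA maxA]] := @Zorn_bigcup V Q.
  case: bD => DZ DD D0; split.
  - move=> t v t0 [Dv|[A FA Av]]; first by left; exact: DZ.
    have [AZ _ _] := FQ _ FA.
    have [Dtv|Atv] := AZ _ _ t0 (or_intror Av); first by left.
    by right; exists A.
  - move=> x y [Dx|[A FA Ax]] [Dy|[B FB By]].
    + by left; exact: DD.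
    + have [_ BD _] := FQ _ FB.
      by have [] := BD x y (or_introl Dx) (or_intror By); [left|right; exists B].
    + have [_ AD _] := FQ _ FA.
      by have [] := AD x y (or_intror Ax) (or_introl Dy); [left|right; exists A].
    + have [AB|BA] := totF _ _ FA FB.
      * have [_ BD _] := FQ _ FB.
        by have [] := BD x y (or_intror (AB _ Ax)) (or_intror By);
          [left|right; exists B].
      * have [_ AD _] := FQ _ FA.
        by have [] := AD x y (or_intror Ax) (or_intror (BA _ By));
          [left|right; exists A].
  - by move=> [//|[A FA A0]]; have [_ _] := FQ _ FA; apply; right.
have [MZ MD M0] := QA.
exists (D `|` A); split; [by split|by move=> x; left|move=> v v0].
have [Mv|nMv] := pselect ((D `|` A) v); first by left.
right; pose N : set V := [set x | exists2 t, 0 < t & exists2 m : V,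
  (D `|` A) m \/ m = 0 & x = m + t *: v].
have addM0 m m' : (D `|` A) m \/ m = 0 -> (D `|` A) m' \/ m' = 0 ->
    (D `|` A) (m + m') \/ m + m' = 0.
  move=> [Mm|->] [Mm'|->]; rewrite ?addr0 ?add0r; last by right.
  - by left; exact: MD.
  - by left.
  - by left.
apply: contrapT => nMNv; have : A `<` A `|` N.
  split; first by move=> x; left.
  move=> /(_ v) AN; apply: nMv; right; apply: AN; right.
  by exists 1 => //; exists 0; [right|rewrite scale1r add0r].
move=> /maxA; apply; rewrite /Q /= setUA; split.
- move=> s x s0 [Mx|[t t0 [m Mm ->]]]; first by left; exact: MZ.
  right; exists (s * t); first exact: mulr_gt0.
  exists (s *: m); last by rewrite scalerDr scalerA.
  by case: Mm => [Mm|->]; [left; exact: MZ|right; rewrite scaler0].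
- move=> x y [Mx|[t t0 [m Mm ->]]] [My|[s s0 [m' Mm' ->]]].
  + by left; exact: MD.
  + right; exists s => //; exists (x + m'); last by rewrite addrA.
    by apply: addM0 => //; left.
  + right; exists t => //; exists (m + y); last by lmod.
    by apply: addM0 => //; left.
  + right; exists (t + s); first exact: addr_gt0.
    by exists (m + m'); [exact: addM0|lmod].
- move=> [//|[t t0 [m Mm mtv]]]; apply: nMNv.
  have nvE : - v = t^-1 *: m.
    have -> : m = - (t *: v) by apply/eqP; rewrite eq_sym eqr_oppLR -subr_eq0
      opprK addrC mtv.
    by rewrite scalerN scalerA mulVf ?scale1r ?gt_eqF.
  rewrite nvE; case: Mm => [Mm|m0]; first by apply: MZ; rewrite ?invr_gt0.
  by case: v0; apply: oppr_inj; rewrite nvE m0 scaler0 oppr0.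
Qed.

(* The order unit [e] of a totally ordering cone [M] turns the supremum of
   [{t | x - t e in M}] into a linear form. *)
Lemma blunt_cone_functional D e : blunt_cone D ->
  (forall v, exists2 t, 0 < t & D (e + t *: v)) ->
  exists f : {linear V -> R^o}, (forall x, D x -> 0 <= f x) /\ f e = 1.
Proof.
move=> bD unit_e; have [M [[MZ MD M0] DM totM]] := blunt_cone_total bD.
have Me : M e.
  by have [t t0] := unit_e 0; rewrite scaler0 addr0 => /DM.
have Mneg t : M (t *: e) -> 0 < t.
  move=> Mte; rewrite ltNge; apply/negP => t0.
  have : M ((- t) *: e + t *: e).
    move: t0; rewrite le_eqVlt => /predU1P[t0|t0].
      by move: Mte; rewrite t0 oppr0 scale0r addr0.
    by apply: MD => //; apply: MZ; rewrite // oppr_gt0.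
  by rewrite -scalerDl addNr scale0r.
have unitM v : exists2 t, 0 < t & M (v + t *: e).
  have [t t0 /DM Mv] := unit_e v; exists t^-1; first by rewrite invr_gt0.
  have -> : v + t^-1 *: e = t^-1 *: (e + t *: v).
    by rewrite scalerDr scalerA mulVf ?gt_eqF// scale1r addrC.
  by apply: MZ; rewrite ?invr_gt0.
pose T x := [set t : R | M (x - t *: e)]; pose f x := sup (T x).
have supT x : has_sup (T x).
  split.
    by have [t t0 Mt] := unitM x; exists (- t); rewrite /T /= scaleNr opprK.
  have [s s0 Ms] := unitM (- x); exists s => t Tt.
  have /Mneg : M ((s - t) *: e).
    have -> : (s - t) *: e = (- x + s *: e) + (x - t *: e) by lmod.
    exact: MD.
  by rewrite subr_gt0 => /ltW.
have f_ub x t : M (x - t *: e) -> t <= f x.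
  by move=> Mt; apply: sup_upper_bound; [exact: supT|].
have f_lt x t : t < f x -> M (x - t *: e).
  rewrite -subr_gt0 => tf.
  have [s Ts] := sup_adherent tf (supT x); rewrite subKr => ts.
  have -> : x - t *: e = (x - s *: e) + (s - t) *: e by lmod.
  by apply: MD => //; apply: MZ; rewrite ?subr_gt0.
have f_le x c : (forall t, t < c -> M (x - t *: e)) -> c <= f x.
  by move=> Mt; apply: le_from_below => t tc; apply: f_ub; exact: Mt.
have fD_ge x y : f x + f y <= f (x + y).
  rewrite -lerBrDr; apply: le_from_below => t tx.
  rewrite lerBrDr addrC -lerBrDr; apply: le_from_below => s sy.
  rewrite lerBrDr; apply: f_ub.
  have -> : x + y - (s + t) *: e = (x - t *: e) + (y - s *: e) by lmod.
  by apply: MD; exact: f_lt.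
have f0 : f 0 = 0.
  apply/eqP; rewrite eq_le; apply/andP; split.
    rewrite leNgt; apply/negP => /f_lt.
    by rewrite scale0r subr0.
  by apply: f_le => t t0; rewrite sub0r -scaleNr; apply: MZ; rewrite ?oppr_gt0.
(* Totality enters here. For [t < - f x], the midpoint u of [f x] and [- t] exceeds [f x], so x - u
   e is not in [M]; it is then zero or has its negative in [M], and either case puts - x - t e in
   [M]. *)
have fN_ge x : - f x <= f (- x).
  apply: f_le => t; rewrite ltrNr => fxt.
  have fxu : f x < (f x - t) / 2 by lra.
  have ut : (f x - t) / 2 < - t by lra.
  have [xu|/eqP xu] := eqVneq (x - ((f x - t) / 2) *: e) 0.
    have -> : - x - t *: e = (- t - (f x - t) / 2) *: e -
      (x - ((f x - t) / 2) *: e) by lmod.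
    by rewrite xu subr0; apply: MZ => //; rewrite subr_gt0.
  have [/f_ub|Mu] := totM _ xu; first by rewrite leNgt fxu.
  have -> : - x - t *: e = (- t - (f x - t) / 2) *: e +
    - (x - ((f x - t) / 2) *: e) by lmod.
  by apply: MD => //; apply: MZ => //; rewrite subr_gt0.
have fN x : f (- x) = - f x.
  apply/eqP; rewrite eq_le fN_ge andbT.
  by have := fD_ge x (- x); rewrite subrr f0; lra.
have fD x y : f (x + y) = f x + f y.
  apply/eqP; rewrite eq_le fD_ge andbT.
  by have := fD_ge (x + y) (- y); rewrite addrK fN; lra.
have fZ_ge c x : 0 < c -> c * f x <= f (c *: x).
  move=> c0; apply: f_le => t tc.
  have -> : c *: x - t *: e = c *: (x - (c^-1 * t) *: e).
    by rewrite scalerBr scalerA mulVKf ?gt_eqF.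
  by apply: MZ => //; apply: f_lt; rewrite mulrC ltr_pdivrMr // mulrC.
have fZpos c x : 0 < c -> f (c *: x) = c * f x.
  move=> c0; apply/eqP; rewrite eq_le fZ_ge // andbT.
  have ic0 : 0 < c^-1 by rewrite invr_gt0.
  have := fZ_ge _ (c *: x) ic0.
  by rewrite scalerA mulVf ?gt_eqF // scale1r ler_pdivrMl.
have fZ c x : f (c *: x) = c * f x.
  have [c0|c0|->] := ltgtP c 0; last by rewrite scale0r f0 mul0r.
    by rewrite -[c in LHS]opprK scaleNr fN fZpos ?oppr_gt0 // mulNr opprK.
  exact: fZpos.
have lin_f : linear (f : V -> R^o) by move=> c x y; rewrite fD fZ.
have [g gE] := bundle_linear lin_f; exists g; split.
  move=> x Dx; rewrite gE; apply: f_ub; rewrite scale0r subr0; exact: DM.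
rewrite gE; apply/eqP; rewrite eq_le; apply/andP; split.
  rewrite leNgt; apply/negP => /f_lt; rewrite scale1r subrr; exact: M0.
apply: f_le => t t1; have -> : e - t *: e = (1 - t) *: e by lmod.
by apply: MZ; rewrite ?subr_gt0.
Qed.

End ConeFunctional.

(** * Topological vector spaces and ordering cones *)

Lemma convex_set_segment (R : realType) (V : lmodType R) (A : set V) (x y : V)
    (t s : R) : convex_set A -> A x -> A y -> 0 < t -> 0 < s ->
  exists2 z, A z & t *: x + s *: y = (t + s) *: z.
Proof.
move=> cA Ax Ay t0 s0; have ts0 : 0 < t + s by exact: addr_gt0.
have l0 : 0 <= t / (t + s) by rewrite divr_ge0 // ltW.
have l1 : t / (t + s) <= 1 by rewrite ler_pdivrMr // mul1r lerDl ltW.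
have := cA x y (Itv01 l0 l1) (mem_set Ax) (mem_set Ay).
move=> /set_mem Az; eexists; first exact: Az.
have -> : (conv (Itv01 l0 l1) (x : convex_lmodType V) y) =
  (t / (t + s)) *: x + (1 - t / (t + s)) *: y by [].
rewrite scalerDr !scalerA mulrBr mulrCA mulfV ?gt_eqF // !mulr1.
by rewrite addrAC subrr add0r.
Qed.

Section Tvs.
Variables (R : realType) (V : tvsType R).

Lemma cvg_scale_fixed (T : Type) (F : set_system T) (FF : Filter F)
    (s : T -> R^o) (k : R^o) (v : V) : s @ F --> k -> (fun x => s x *: v) @ F --> k *: v.
Proof.
move=> sk; exact: (@continuous2_cvg _ _ _ _ F _ s (fun=> v) (fun (x : R^o) (y : V) => x *: y)
  k v (@scale_continuous R V (k, v)) sk (cvg_cst v)).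
Qed.

Lemma nbhs_line (U : set V) (a v : V) : nbhs a U ->
  exists2 e : R, 0 < e & forall t, `|t| <= e -> U (a + t *: v).
Proof.
move=> Ua.
have lineC : (fun t : R^o => a + t *: v) @ (0 : R^o) --> a.
  have tv : (fun t : R^o => t *: v) @ (0 : R^o) --> (0 : R^o) *: v.
    exact: (@cvg_scale_fixed R^o (nbhs (0 : R^o)) _ id 0 v cvg_id).
  have := @continuous2_cvg _ _ _ _ (nbhs (0 : R^o)) _ (fun=> a) _ (fun x y : V => x + y)
    _ _ (@add_continuous V (a, (0 : R^o) *: v)) (cvg_cst a) tv.
  by rewrite scale0r addr0; apply.
have /nbhs_ballP[e /= e0 Be] := lineC _ Ua.
exists (e / 2); first by rewrite divr_gt0.
move=> t te; apply: Be; rewrite /ball /= sub0r normrN.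
by apply: le_lt_trans te _; rewrite ltr_pdivrMr // mulr_natr mulr2n ltrDl.
Qed.

(** On the intersection of [U] with its negative, the absolute value of [f] is at most that of [c];
    shrinking this neighborhood makes the bound arbitrarily small. *)
Lemma linear_bounded_below_continuous (f : {linear V -> R^o}) (U : set V) (c : R) :
  nbhs 0 U -> (forall u, U u -> c <= f u) -> continuous f.
Proof.
move=> U0 fU x; apply/cvgrPdist_le => e e0.
have c0 : 0 < 1 + `|c| by rewrite ltr_pwDl.
have ec : 0 < e / (1 + `|c|) by rewrite divr_gt0.
have U'0 : nbhs 0 (U `&` -%R @` U) by apply: filterI => //; exact: nbhs0N.
have := nbhsT x (nbhs0Z (lt0r_neq0 ec) U'0).
apply: filterS => _ [_ [u [Uu [u' Uu' u'u]] <-] <-].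
rewrite linearD linearZ /= opprD addrA subrr sub0r normrN normrM.
rewrite (gtr0_norm ec) mulrAC ler_pdivrMr // ler_wpM2l ?(ltW e0) //.
have fu := fU _ Uu; have := fU _ Uu'; rewrite -[u']opprK u'u linearN => fu'.
have cc : - `|c| <= c by rewrite lerNl -normrN ler_norm.
by rewrite ler_norml; apply/andP; split; lra.
Qed.

End Tvs.

(** * Interior points of the ordering cone and positive functionals *)

Section OrderingCone.
Variables (R : realType) (Y : tvsType R) (K : set Y).
Hypotheses (K_proper : K <> setT) (K_closed : closed K) (K_cone : convex_cone K)
  (K_int : interior K !=set0).
Implicit Types a b k : Y.

Lemma K_D a b : K a -> K b -> K (a + b).
Proof.
move=> Ka Kb; have [KZ Kc] := K_cone.
have [z Kz] := convex_set_segment Kc Ka Kb ltr01 ltr01.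
by rewrite !scale1r => ->; exact: KZ.
Qed.

Lemma K_Z t a : 0 < t -> K a -> K (t *: a).
Proof. by move=> t0; apply: (K_cone.1). Qed.

Lemma intK_K k : interior K k -> K k.
Proof. exact: interior_subset. Qed.

Lemma intK_DK a b : interior K a -> K b -> interior K (a + b).
Proof.
move=> Ka Kb; rewrite addrC; have := nbhsB b Ka.
by apply: filterS => _ [k Kk <-]; exact: K_D.
Qed.

Lemma intK_D a b : interior K a -> interior K b -> interior K (a + b).
Proof. by move=> Ka Kb; apply: intK_DK => //; exact: intK_K. Qed.

Lemma intK_Z t a : 0 < t -> interior K a -> interior K (t *: a).
Proof.
move=> t0 Ka; have := nbhsZ (lt0r_neq0 t0) Ka.
by apply: filterS => _ [k Kk <-]; exact: K_Z.
Qed.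

Lemma intK_line a v : interior K a ->
  exists2 e : R, 0 < e & forall t, `|t| <= e -> interior K (a + t *: v).
Proof. by move=> Ka; apply: nbhs_line; exact: nbhs_interior. Qed.

(** A [cone] need not contain 0; closedness supplies it as the limit of small multiples of an
    interior point. *)
Lemma K_0 : K 0.
Proof.
have [k /intK_K Kk] := K_int; apply: K_closed => B B0.
have [e e0 Be] := nbhs_line k B0.
exists (e *: k); split; first exact: K_Z.
by rewrite -[_ *: _]add0r; apply: Be; rewrite gtr0_norm.
Qed.

Lemma intK_absorb a v : interior K a -> exists2 t : R, 0 < t & interior K (v + t *: a).
Proof.
move=> Ka; have [e e0 /(_ e)] := intK_line v Ka; rewrite gtr0_norm //.
move=> /(_ (lexx _)) Kav; exists e^-1; first by rewrite invr_gt0.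
have -> : v + e^-1 *: a = e^-1 *: (a + e *: v).
  by rewrite scalerDr scalerA mulVf ?gt_eqF // scale1r addrC.
by apply: intK_Z; rewrite ?invr_gt0.
Qed.

(** An interior point is an order unit; if 0 were one, [K] would be the whole space. *)
Lemma intK_not0 : ~ interior K 0.
Proof.
move=> K0; apply: K_proper; apply/seteqP; split=> // v _.
by have [t _] := intK_absorb v K0; rewrite scaler0 addr0 => /intK_K.
Qed.

Lemma intK_not_opp a : K a -> ~ interior K (- a).
Proof. by move=> Ka Kna; apply: intK_not0; rewrite -(addNr a); exact: intK_DK. Qed.

Section PositiveFunctional.
Variable f : {linear Y -> R^o}.
Hypothesis f_ge0 : forall k, interior K k -> 0 <= f k.

(** Adding a small multiple of an interior point [k0] moves [k] into the interior, and the multiple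
    tends to 0. *)
Lemma functional_K_ge0 k : K k -> 0 <= f k.
Proof.
move=> Kk; have [k0 Kk0] := K_int; have f0 := f_ge0 Kk0.
apply/ler_addgt0Pr => e e0.
have d0 : 0 < e / (1 + f k0) by rewrite divr_gt0 // ltr_pwDl.
have := f_ge0 (intK_DK (intK_Z d0 Kk0) Kk).
rewrite linearD linearZ /= addrC => /le_trans; apply; rewrite lerD2l.
rewrite /GRing.scale /= mulrAC ler_pdivrMr ?ltr_pwDl // ler_wpM2l ?(ltW e0) //.
by rewrite lerDr.
Qed.

(** If [f k] were 0, small steps from [k] along both [v] and [- v] would stay in the interior and
    force [f v = 0]. *)
Lemma functional_intK_gt0 k v : f v != 0 -> interior K k -> 0 < f k.
Proof.
move=> fv Kk; rewrite lt_neqAle f_ge0 // andbT eq_sym; apply: contra fv => /eqP fk.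
have [e e0 He] := intK_line v Kk.
have := f_ge0 (He e _); rewrite gtr0_norm // => /(_ (lexx _)).
have := f_ge0 (He (- e) _); rewrite normrN gtr0_norm // => /(_ (lexx _)).
rewrite !linearD !linearZ /= fk !add0r /GRing.scale /= mulNr oppr_ge0.
by rewrite pmulr_rle0 // pmulr_rge0 // => f1 f2; rewrite eq_le f1 f2.
Qed.

End PositiveFunctional.
End OrderingCone.

(* Scalar functionals become operators into Y along a fixed direction [k]. *)
Lemma rank_one (R : realType) (V Y : tvsType R) (f : {linear V -> R^o}) (k : Y) :
  continuous f -> exists T : {linear V -> Y}, continuous T /\ forall v, T v = f v *: k.
Proof.
move=> f_cont; have lin_T : linear (fun v => f v *: k).
  by move=> a u v; rewrite linearD linearZ scalerDl scalerA.
have [T TE] := bundle_linear lin_T; exists T; split=> // x.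
rewrite (_ : (T : V -> Y) = (fun v => f v *: k)); last exact/funext.
exact: (@cvg_scale_fixed _ _ V (nbhs x) _ f (f x) k (f_cont x)).
Qed.

(** * Weak suprema and infima *)

Section WeakExtrema.
Variables (R : realType) (Y : tvsType R) (K : set Y).
Hypotheses (K_closed : closed K) (K_cone : convex_cone K)
  (K_int : interior K !=set0).
Implicit Types (a b : Y) (u v m : bext Y) (M : set (bext Y)).

Lemma setNE (Q : set Y) a b : setN Q (a - b) <-> Q (b - a).
Proof.
rewrite -(opprB a b); split=> [[q Qq <-]|Qab]; first by rewrite opprK.
by exists (- (a - b)); rewrite ?opprK.
Qed.

Lemma clt_fin a b : clt K (BFin a) (BFin b) <-> interior K (b - a).
Proof. exact: setNE. Qed.

Lemma cle_fin a b : cle K (UFin a) (UFin b) <-> K (b - a).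
Proof. exact: setNE. Qed.

Lemma clt_bopp u v : clt K (bopp u) (bopp v) <-> clt K v u.
Proof.
case: u v => [a||] [b||] //; rewrite /bopp !clt_fin.
by rewrite opprK addrC.
Qed.

Lemma boppK : involutive (@bopp Y).
Proof. by case=> //= a; rewrite opprK. Qed.

Lemma WInfP M v : WInf K M v <->
  (forall m, M m -> ~ clt K m v) /\ (forall u, clt K v u -> exists2 m, M m & clt K m u).
Proof.
split=> [[w [w_ub w_lub] <-]|[v_lb v_glb]].
  split=> [m Mm|u].
    rewrite -clt_bopp boppK; apply: w_ub; by exists m.
  rewrite -clt_bopp boppK => /w_lub[_ [m Mm <-]].
  by rewrite clt_bopp; exists m.
exists (bopp v); last exact: boppK.
split=> [_ [m Mm <-]|u]; first by rewrite clt_bopp; exact: v_lb.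
rewrite -clt_bopp boppK => /v_glb[m Mm mu].
by exists (bopp m); [exists m|rewrite -clt_bopp boppK].
Qed.

Lemma clt_fin_le m a b : K (b - a) -> clt K m (BFin a) -> clt K m (BFin b).
Proof.
case: m => [c||] // Kab; rewrite !clt_fin => Kca.
have -> : b - c = (a - c) + (b - a) by lmod.
exact: intK_DK.
Qed.

Lemma clt_lower a b u : K (b - a) -> clt K (BFin b) u -> clt K (BFin a) u.
Proof.
case: u => [c||] // Kab; rewrite !clt_fin => Kbc.
have -> : c - a = (c - b) + (b - a) by lmod.
exact: intK_DK.
Qed.

(* Moving from [a] along an interior direction of [K] reaches the boundary of
   the set of lower bounds. *)
Lemma WInf_above M (m0 : Y) a : M (BFin m0) -> (forall m, M m -> ~ clt K m (BFin a)) ->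
  exists2 b, K (b - a) & WInf K M (BFin b).
Proof.
move=> Mm0 a_lb; have [k0 Kk0] := K_int.
pose T := [set t : R | 0 <= t /\ forall m, M m -> ~ clt K m (BFin (a + t *: k0))].
have T0 : T 0 by split=> // m; rewrite scale0r addr0; exact: a_lb.
(* From parameter [t1] on, the ray lies strictly above [m0]; this bounds [T]. *)
have [t1 t1_gt0 Kt1] := intK_absorb K_cone (a - m0) Kk0.
have shift s t : s <= t -> K ((a + t *: k0) - (a + s *: k0)).
  have -> : (a + t *: k0) - (a + s *: k0) = (t - s) *: k0 by lmod.
  rewrite le_eqVlt => /predU1P[->|st].
    by rewrite subrr scale0r; exact: K_0.
  by apply: K_Z; rewrite ?subr_gt0 //; exact: intK_K.
have supT : has_sup T.
  split; first by exists 0.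
  exists t1 => t [_ Tt]; rewrite leNgt; apply/negP => /ltW /shift t1t.
  apply: (Tt _ Mm0); apply: clt_fin_le t1t _.
  by rewrite clt_fin addrAC.
have s_ge0 : 0 <= sup T by apply: sup_upper_bound.
exists (a + sup T *: k0).
  by have := shift _ _ s_ge0; rewrite scale0r addr0.
apply/WInfP; split=> [m Mm|[c||] //].
(* A value strictly below the point at [sup T] stays so after a small step back along [k0], hence
   lies strictly below a point whose parameter is in [T]. *)
- case: m Mm => [m||] Mm; [|by case|exact: (a_lb _ Mm)].
  rewrite clt_fin => Kms; have [e e0 /(_ (- e))] := intK_line k0 Kms.
  rewrite normrN gtr0_norm // => /(_ (lexx _)) Kme.
  have [t [_ Tt] te] := sup_adherent e0 supT.
  apply: (Tt _ Mm); apply: clt_fin_le (shift _ _ (ltW te)) _.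
  rewrite clt_fin.
  by have -> : a + (sup T - e) *: k0 - m = a + sup T *: k0 - m + - e *: k0 by lmod.
(* A point strictly above the one at [sup T] is also above the one at [sup T + e] for a small [e],
   and that parameter is not in [T]. *)
- rewrite clt_fin => Ksc; have [e e0 /(_ (- e))] := intK_line k0 Ksc.
  rewrite normrN gtr0_norm // => /(_ (lexx _)) Kce.
  have : ~ T (sup T + e).
    by move=> /(sup_upper_bound supT); rewrite gerDl leNgt e0.
  move=> nT; apply: contrapT => c_lb; apply: nT; split; first by rewrite addr_ge0 // ltW.
  move=> m Mm mlt; apply: c_lb; exists m => //.
  apply: clt_fin_le mlt.
  have -> : c - (a + (sup T + e) *: k0) = c - (a + sup T *: k0) + - e *: k0 by lmod.
  exact: intK_K.
- by move=> _; exists (BFin m0).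
Qed.

(* Abstract Lagrange duality: [NN] is the family of sets of Lagrangian values,
   one for each pair of multipliers. *)
Lemma WInf_eq_WMax M (NN : set (set (bext Y))) (D : set (bext Y)) (m0 : Y) :
  (forall d, D d <-> exists2 N, NN N & WInf K N d) ->
  M (BFin m0) -> NN !=set0 ->
  (forall N m u, NN N -> M m -> clt K m u -> exists2 n, N n & clt K n u) ->
  (forall b, WInf K M (BFin b) ->
    exists2 N, NN N & forall n, N n -> ~ clt K n (BFin b)) ->
  WInf K M = WMax K D.
Proof.
move=> DE Mm0 [N0 NN0] weak strong.
have weakD d m : D d -> M m -> ~ clt K m d.
  move=> /DE[N NNN /WInfP[d_lb _]] Mm /(weak _ _ _ NNN Mm)[n Nn].
  exact: d_lb.
have WInf_D v : WInf K M v -> D v.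
  move=> WMv; have /WInfP[v_lb v_glb] := WMv; apply/DE.
  case: v => [b||] in WMv v_lb v_glb *.
  - have [N NNN b_lb] := strong _ WMv; exists N => //.
    apply/WInfP; split=> // u /v_glb[m Mm mu]; exact: (weak _ _ _ NNN Mm mu).
  - by case: (v_lb _ Mm0).
  (* For the value minus infinity, weak duality alone suffices, with any member of [NN]. *)
  - exists N0 => //; apply/WInfP; split=> [[c||] _ []|u /v_glb[m Mm mu]].
    exact: (weak _ _ _ NN0 Mm mu).
apply/seteqP; split=> [v WMv|d [Dd [d_ub d_lub]]].
  split; first exact: WInf_D.
  split=> [d Dd vd|u uv]; last by exists v => //; exact: WInf_D.
  have /WInfP[_ v_glb] := WMv; have [m Mm] := v_glb _ vd.
  exact: weakD.
apply/WInfP; split=> [m|u du]; first exact: weakD.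
(* If no value of [M] is strictly below [u], a finite [u] can be raised to an element of [WInf K M];
   that element lies in [D] strictly above [d], against the maximality of [d]. *)
apply: contrapT => u_lb.
have {}u_lb m : M m -> ~ clt K m u by move=> Mm mu; apply: u_lb; exists m.
case: u => [a||] in du u_lb.
- have [b Kab WMb] := WInf_above Mm0 u_lb.
  by apply: (d_ub _ (WInf_D _ WMb)); exact: clt_fin_le du.
- exact: (u_lb _ Mm0).
- by case: d {Dd d_ub d_lub} du.
Qed.

End WeakExtrema.

(** * Separation *)

Lemma nonneg_limit (R : realFieldType) (a c : R) :
  (forall s, 0 < s -> 0 <= a + s * c) -> 0 <= a.
Proof.
move=> h; apply: le_from_below => z z0.
have d0 : 0 < 1 + `|c| by rewrite ltr_pwDl.
have nz0 : 0 < - z / (1 + `|c|) by rewrite divr_gt0 // oppr_gt0.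
have := h _ nz0; suff : - z / (1 + `|c|) * c <= - z by lra.
rewrite mulrAC ler_pdivrMr // ler_wpM2l ?oppr_ge0 ?(ltW z0) //.
by apply: le_trans (ler_norm c) _; rewrite lerDr.
Qed.

(** With s = 1/t the hypothesis reads [0 <= c + s * a], and s tends to 0. *)
Lemma nonneg_slope (R : realFieldType) (a c : R) :
  (forall t, 0 < t -> 0 <= a + t * c) -> 0 <= c.
Proof.
move=> h; apply: (@nonneg_limit _ c a) => s s0.
have := h s^-1; rewrite invr_gt0 => /(_ s0).
by rewrite -(pmulr_rge0 _ s0) mulrDr mulVKf ?gt_eqF // addrC.
Qed.

Section Separation.
Variables (R : realType) (U Y : tvsType R) (K : set Y).
Hypothesis K_cone : convex_cone K.
Variables (E : set (U * Y)) (A : set U) (y0 y1 : Y).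
Hypotheses
  (E_nonempty : E !=set0)
  (E_segment : forall (e e' : U * Y) (t s : R), E e -> E e' -> 0 < t -> 0 < s ->
    exists2 e2, E e2 & t *: e + s *: e' = (t + s) *: e2)
  (E_up : forall u y k, E (u, y) -> interior K k -> E (u, y + k))
  (E_line : forall u y v, E (u, y) ->
    exists2 d : R, 0 < d & forall t, `|t| <= d -> E (u, y + t *: v))
  (E_not : ~ E (0, y0))
  (A_convex : convex_set A) (A_nbhs : nbhs 0 A)
  (A_E : forall v e (c : R), A v -> E e -> v = c *: e.1 -> E (v, y1)).

(* [A] is a neighborhood in the whole of [U], but only its points that are
   multiples of points below [E] have to lie under [E]; this spares extending
   functionals from a subspace of [U]. *)
Lemma separation : exists (g : {linear U -> R^o}) (h : {linear Y -> R^o}),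
  [/\ continuous g, forall k, interior K k -> 0 <= h k, exists v, h v != 0 &
      forall u y, E (u, y) -> h y0 <= g u + h y].
Proof.
pose b0 : U * Y := (0, y0).
pose B : set (U * Y) := [set p | A p.1 /\ p.2 = y1].
have B_segment (p p' : U * Y) (t s : R) : B p -> B p' -> 0 < t -> 0 < s ->
    exists2 p2, B p2 & t *: p + s *: p' = (t + s) *: p2.
  move=> [Ap p1] [Ap' p'1] t0 s0.
  have [z Az zE] := convex_set_segment A_convex Ap Ap' t0 s0.
  exists (z, y1) => //; apply: injective_projections; rewrite /= ?p1 ?p'1 //.
  by lmod.
(* A form nonnegative on [D] puts [b0] below both [E] and the horizontal slice [B]; the slice is
   what bounds the form near 0 in [U] and makes it continuous. *)
pose D : set (U * Y) := [set x | exists t s, [/\ 0 < t, 0 < s & exists e p,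
  [/\ E e, B p & x = t *: (e - b0) + s *: (p - b0)]]].
have bD : blunt_cone D.
  split.
  - move=> r x r0 [t [s [t0 s0 [e [p [Ee Bp ->]]]]]].
    exists (r * t), (r * s); split; rewrite ?mulr_gt0 //.
    by exists e, p; split=> //; lmod.
  - move=> _ _ [t [s [t0 s0 [e [p [Ee Bp ->]]]]]] [t' [s' [t'0 s'0 [e' [p' [Ee' Bp' ->]]]]]].
    have [e2 Ee2 e2E] := E_segment Ee Ee' t0 t'0.
    have [p2 Bp2 p2E] := B_segment _ _ _ _ Bp Bp' s0 s'0.
    exists (t + t'), (s + s'); split; rewrite ?addr_gt0 //.
    exists e2, p2; split=> //.
    have -> : (t + t') *: (e2 - b0) + (s + s') *: (p2 - b0) =
      (t + t') *: e2 + (s + s') *: p2 - (t + t' + (s + s')) *: b0 by lmod.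
    by rewrite -e2E -p2E; lmod.
  (* If 0 were in [D], the base point [v] would be a negative multiple of [e.1]; then [A_E] puts
     [(v, y1)] in [E], and [b0] becomes a convex combination of two points of [E]. *)
  - move=> [t [s [t0 s0 [e [[v y] [Ee [/= Av ->] /esym epE]]]]]].
    have b0E : t *: e + s *: (v, y1) = (t + s) *: b0.
      by apply/eqP; rewrite -subr_eq0 -epE; apply/eqP; lmod.
    have Ev : E (v, y1).
      apply: (@A_E v e (- (t / s))) => //.
      have : t *: e.1 + s *: v = 0.
        have /= -> := congr1 fst b0E; exact: scaler0.
      move/eqP; rewrite addrC addr_eq0 => /eqP sv.
      rewrite scaleNr mulrC -scalerA -scalerN -sv scalerA mulVf ?scale1r //.
      exact: lt0r_neq0.
    have [e2 Ee2] := E_segment Ee Ev t0 s0.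
    rewrite b0E => /scalerI b0e2; apply: E_not; rewrite -/b0 b0e2 //.
    by apply: lt0r_neq0; exact: addr_gt0.
have [[u0 z0] Ee0] := E_nonempty.
have A0 : A 0 by exact: nbhs_singleton.
(* [E] has room around its point in vertical directions and [B] in horizontal ones, so this sum is
   an order unit for [D]. *)
pose unit : U * Y := ((u0, z0) - b0) + ((0, y1) - b0).
have unitD v : exists2 t, 0 < t & D (unit + t *: v).
  case: v => [u y].
  have [d d0 Ed] := E_line y Ee0; have [d' d'0 Ad'] := nbhs_line u A_nbhs.
  have m0 : 0 < Num.min d d' by rewrite lt_min d0.
  exists (Num.min d d') => //; exists 1, 1; split=> //.
  exists (u0, z0 + Num.min d d' *: y), (Num.min d d' *: u, y1); split.
  - by apply: Ed; rewrite gtr0_norm // ge_min lexx.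
  - split=> //=; rewrite -[_ *: u]add0r; apply: Ad'.
    by rewrite gtr0_norm // ge_min lexx orbT.
  - by apply: injective_projections => /=; lmod.
have [f [f_ge0 f_unit]] := blunt_cone_functional bD unitD.
have fE e : E e -> 0 <= f e - f b0.
  move=> Ee; apply: (@nonneg_limit _ _ (f ((0, y1) - b0))) => s s0.
  rewrite -linearB -[f (e - b0)]mul1r.
  have -> : 1 * f (e - b0) + s * f ((0, y1) - b0) =
    f (1 *: (e - b0) + s *: ((0, y1) - b0)) by rewrite [in RHS]linearD !linearZ.
  by apply: f_ge0; exists 1, s; split=> //; exists e, (0, y1).
have fB p : B p -> 0 <= f p - f b0.
  move=> Bp; apply: (@nonneg_limit _ _ (f ((u0, z0) - b0))) => s s0.
  rewrite -linearB -[f (p - b0)]mul1r addrC.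
  have -> : s * f ((u0, z0) - b0) + 1 * f (p - b0) =
    f (s *: ((u0, z0) - b0) + 1 *: (p - b0)) by rewrite [in RHS]linearD !linearZ.
  by apply: f_ge0; exists s, 1; split=> //; exists (u0, z0), p.
have lin_g : linear ((fun u => f (u, 0)) : U -> R^o).
  move=> a u v; rewrite -linearP; congr (f _).
  by apply: injective_projections => //=; lmod.
have lin_h : linear ((fun y => f (0, y)) : Y -> R^o).
  move=> a u v; rewrite -linearP; congr (f _).
  by apply: injective_projections => //=; lmod.
have [g gE] := bundle_linear lin_g; have [h hE] := bundle_linear lin_h.
have fgh u y : f (u, y) = g u + h y.
  rewrite gE hE -linearD; congr (f _).
  by apply: injective_projections => /=; lmod.
have hb0 : f b0 = h y0 by rewrite hE.
exists g, h; split.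
- apply: (@linear_bounded_below_continuous _ _ _ _ (h y0 - h y1) A_nbhs) => u Au.
  by have := fB (u, y1) (conj Au erefl); rewrite fgh hb0; lra.
- move=> k Kk; apply: (@nonneg_slope _ (g u0 + h z0 - h y0)) => t t0.
  have := fE _ (E_up Ee0 (intK_Z K_cone t0 Kk)).
  by rewrite fgh hb0 linearD linearZ /= /GRing.scale /=; lra.
(* If [h] vanished, [g] would be nonnegative on a neighborhood of 0, hence zero, contradicting
   [f unit = 1]. *)
- apply: contrapT => nh.
  have h0 v : h v = 0 by apply/eqP/negPn/negP => hv; apply: nh; exists v.
  have gA v : A v -> 0 <= g v.
    by move=> Av; have := fB (v, y1) (conj Av erefl); rewrite fgh hb0 !h0 addr0 subr0.
  have g0 u : g u = 0.
    have [d d0 Ad] := nbhs_line u A_nbhs.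
    have := gA _ (Ad d _); rewrite gtr0_norm // => /(_ (lexx _)).
    have := gA _ (Ad (- d) _); rewrite normrN gtr0_norm // => /(_ (lexx _)).
    rewrite !add0r !linearZ /= /GRing.scale /= mulNr oppr_ge0.
    rewrite pmulr_rle0 // pmulr_rge0 // => f1 f2.
    by apply/eqP; rewrite eq_le f1 f2.
  have : f unit = 0 by case: unit {unitD f_unit} => u y; rewrite fgh g0 h0 addr0.
  by rewrite f_unit => /eqP; rewrite oner_eq0.
- by move=> u y /fE; rewrite fgh hb0 subr_ge0.
Qed.

End Separation.

(** * The composite problem *)

Section ConvexMappings.
Variable R : realType.

Definition avg (V : lmodType R) (t s : R) (x y : V) : V :=
  (t + s)^-1 *: (t *: x + s *: y).

Lemma scale_avg (V : lmodType R) (t s : R) (x y : V) : 0 < t -> 0 < s ->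
  t *: x + s *: y = (t + s) *: avg t s x y.
Proof.
by move=> t0 s0; rewrite /avg scalerA mulfV ?scale1r // lt0r_neq0 // addr_gt0.
Qed.

Lemma linear_avg (V V' : lmodType R) (f : {linear V -> V'}) (t s : R) (x y : V) :
  f (avg t s x y) = avg t s (f x) (f y).
Proof. by rewrite /avg linearZ linearD !linearZ. Qed.

Lemma convex_set_avg (V : lmodType R) (A : set V) (x y : V) (t s : R) :
  convex_set A -> A x -> A y -> 0 < t -> 0 < s -> A (avg t s x y).
Proof.
move=> cA Ax Ay t0 s0; have [z Az] := convex_set_segment cA Ax Ay t0 s0.
rewrite scale_avg // => /scalerI -> //.
by rewrite lt0r_neq0 // addr_gt0.
Qed.

Lemma cone_convex_avg (X V : lmodType R) (Q : set V) (E : X -> uext V)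
    (x x' : X) (v v' q q' : V) (t s : R) : cone_convex Q E ->
  E x = UFin v -> E x' = UFin v' -> Q q -> Q q' -> 0 < t -> 0 < s ->
  exists v2 q2, [/\ E (avg t s x x') = UFin v2, Q q2 &
    avg t s (v + q) (v' + q') = v2 + q2].
Proof.
move=> cE Ex Ex' Qq Qq' t0 s0.
have Ev : [set p : X * V | exists2 v : V, E p.1 = UFin v &
    exists2 q, Q q & p.2 = v + q] (x, v + q).
  by exists v => //; exists q.
have Ev' : [set p : X * V | exists2 v : V, E p.1 = UFin v &
    exists2 q, Q q & p.2 = v + q] (x', v' + q').
  by exists v' => //; exists q'.
by have [v2 /= Ev2 [q2 Qq2 qE]] := convex_set_avg cE Ev Ev' t0 s0; exists v2, q2.
Qed.

End ConvexMappings.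

(** * Membership in the domain of the conjugate, through bounds *)

Section Multipliers.
Variables (R : realType) (W Y : tvsType R) (K : set Y).
Hypotheses (K_cone : convex_cone K) (K_int : interior K !=set0).
Variables (kappa : W -> uext Y).

(** The translate K - k0 is a neighborhood of 0 on which [f] is at least [- f k0]. *)
Lemma functional_continuous (f : {linear Y -> R^o}) :
  (forall k, interior K k -> 0 <= f k) -> continuous f.
Proof.
move=> f_ge0; have [k0 Kk0] := K_int.
have := nbhsB (- k0) Kk0; rewrite addNr => U0.
apply: (linear_bounded_below_continuous (c := - f k0) U0) => _ [k Kk <-].
rewrite linearD linearN lerDl; exact: (functional_K_ge0 K_cone K_int f_ge0 Kk).
Qed.

(** If the conjugate were plus infinity alone, some [T w - b] would lie strictly above the multiple
    of [k0] at which [f] equals [c]. *)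
Lemma dom_conjugate_of_bound (f : {linear Y -> R^o}) (k0 : Y) (T : {linear W -> Y})
    (c : R) :
  (forall k, interior K k -> 0 <= f k) -> 0 < f k0 -> continuous T ->
  (forall w b, kappa w = UFin b -> f (T w - b) <= c) -> dom_conjugate K kappa T.
Proof.
move=> f_ge0 fk0 cT Tc; split=> // conjE.
have [_ lub] : conjugate K kappa T BPInf by rewrite conjE.
have fgt0 k : interior K k -> 0 < f k.
  by apply: (functional_intK_gt0 f_ge0 (lt0r_neq0 fk0)).
have [_ [w _ <-]] := lub (BFin ((c / f k0) *: k0)) I.
case kw : (kappa w) => [b|] //=.
rewrite -/(clt K (BFin _) (BFin _)) clt_fin => /fgt0.
rewrite linearB linearZ /= /GRing.scale /= divfK ?lt0r_neq0 //.
by have := Tc _ _ kw; lra.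
Qed.

(** Otherwise every finite [y] has a value strictly above it while no value is plus infinity, which
    makes plus infinity the only weak supremum. *)
Lemma dom_conjugate_bound (T : {linear W -> Y}) : uproper kappa -> dom_conjugate K kappa T ->
  exists y, forall w b, kappa w = UFin b -> ~ interior K (T w - b - y).
Proof.
move=> [w0 kw0] [_ conjN]; apply: contrapT => nby; apply: conjN.
have big y : exists2 m, [set btranslate (T w) (bopp (u2b (kappa w))) | w in [set: W]] m
    & clt K (BFin y) m.
  apply: contrapT => nm; apply: nby; exists y => w b kw Kw; apply: nm.
  by exists (BFin (T w - b)); [exists w => //; rewrite kw|rewrite clt_fin].
have noInf w : btranslate (T w) (bopp (u2b (kappa w))) <> BPInf.
  by case: (kappa w).
apply/seteqP; split=> [[y||] [ub lub]|_ ->] //.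
- by have [m Mm ym] := big y; case: (ub m Mm).
- have [m Mm ym] := big 0.
  have : clt K BNInf m by case: m ym {Mm}.
  by move=> /(ub m Mm).
- split=> [_ [w _ <-]|[y||] // _].
    by case: (btranslate _ _) => [?||] [].
  have [m Mm ym] := big 0; exists m => //.
  by case: m ym {Mm}.
Qed.

End Multipliers.

Section Composite.
Variables (R : realType) (X Y Z W : tvsType R).
Variables (K : set Y) (P : set W) (S : set Z) (C : set X).
Hypotheses (K_proper : K <> setT) (K_closed : closed K) (K_cone : convex_cone K)
  (K_int : interior K !=set0)
  (P_nonempty : P !=set0) (P_cone : convex_cone P)
  (S_cone : convex_cone S).
Variables (F : X -> uext Y) (kappa : W -> uext Y) (H : X -> uext W) (G : X -> uext Z).
Hypotheses (kappa_proper : uproper kappa)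
  (F_convex : cone_convex K F) (H_convex : cone_convex P H)
  (G_convex : cone_convex S G) (kappa_convex : cone_convex K kappa)
  (kappa_nondecreasing : nondecreasing_cone K P kappa)
  (C_convex : convex_set C).

Lemma kappa_shift w b p : P p -> kappa w = UFin b ->
  exists2 b', kappa (w - p) = UFin b' & K (b - b').
Proof.
move=> Pp kw; have : cle K (kappa (w - p)) (kappa w).
  by apply: kappa_nondecreasing; exists p => //; lmod.
rewrite kw; case: (kappa _) => [b'|] //.
by rewrite cle_fin => Kb; exists b'.
Qed.

(** Separating 0 from the values [y0 - T w + b + k] gives a scalar [h] for which h (T w - b) is
    bounded above; monotonicity of [kappa] then makes [h \o T] nonnegative on [P], and a direction
    in [K] turns it back into an operator. *)
Lemma dom_conjugate_Lplus_nonempty : dom_conjugate K kappa !=set0 ->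
  (dom_conjugate K kappa `&` Lplus K P) !=set0.
Proof.
move=> [T domT]; have [k0 Kk0] := K_int; have cT := domT.1.
(* In [E] the factor [R^o] is a dummy: all points lie over 0, and only the separation in [Y]
   matters. *)
have [y0 y0_ub] := dom_conjugate_bound kappa_proper domT.
pose E : set (R^o * Y) := [set e | e.1 = 0 /\ exists w b k,
  [/\ kappa w = UFin b, interior K k & e.2 = y0 - T w + b + k]].
have [w0] := kappa_proper; rewrite /udom /=; case kw0 : (kappa w0) => [b0|] // _.
have Ew0 k : interior K k -> E (0, y0 - T w0 + b0 + k).
  by move=> Kk; split=> //; exists w0, b0, k.
have [|e e' t s|u y k|u y v||||v e c _|f [h [_ h_ge0 [v hv] hE]]] :=
    @separation R R^o Y K K_cone E setT 0 (y0 - T w0 + b0 + k0).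
- by exists (0, y0 - T w0 + b0 + k0); exact: Ew0.
- case: e e' => [u y] [u' y'] [/= -> [w [b [k [kw Kk ->]]]]].
  move=> [/= -> [w' [b' [k' [kw' Kk' ->]]]]] t0 s0.
  have K0 := K_0 K_closed K_cone K_int.
  have [b2 [q [kw2 Kq bE]]] := cone_convex_avg kappa_convex kw kw' K0 K0 t0 s0.
  exists (0, y0 - T (avg t s w w') + b2 + (q + avg t s k k')).
    split=> //; exists (avg t s w w'), b2, (q + avg t s k k'); split=> //.
    rewrite addrC; apply: intK_DK => //; apply: intK_Z; rewrite ?invr_gt0 ?addr_gt0 //.
    by apply: intK_D => //; exact: intK_Z.
  apply: injective_projections; first by rewrite /= !scaler0 addr0.
  have -> : y0 - T (avg t s w w') + b2 + (q + avg t s k k') =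
    y0 - T (avg t s w w') + avg t s (b + 0) (b' + 0) + avg t s k k'.
    by rewrite bE; lmod.
  rewrite /= linear_avg.
  have -> : (t + s) *: (y0 - avg t s (T w) (T w') + avg t s (b + 0) (b' + 0) +
      avg t s k k') = (t + s) *: y0 - (t + s) *: avg t s (T w) (T w') +
      (t + s) *: avg t s (b + 0) (b' + 0) + (t + s) *: avg t s k k' by lmod.
  by rewrite -!scale_avg //; lmod.
- move=> [/= u0 [w [b [k' [kw Kk' ->]]]]] Kk; split=> //; exists w, b, (k' + k).
  by split=> //; [exact: intK_D|rewrite /= addrA].
- move=> [/= u0 [w [b [k [kw Kk ->]]]]]; have [d d0 Kd] := intK_line v Kk.
  exists d => // t td; split=> //; exists w, b, (k + t *: v).
  by split=> //; [exact: Kd|rewrite /= addrA].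
- move=> [_ [w [b [k [kw Kk /= /eqP E0]]]]]; apply: (y0_ub _ _ kw).
  suff -> : T w - b - y0 = k by [].
  by apply/eqP; rewrite -subr_eq0; move: E0; rewrite eq_sym -oppr_eq0;
    congr (_ == 0); lmod.
- by move=> x y l _ _; rewrite inE.
- exact: filterT.
- by move=> [-> _] ->; rewrite scaler0; exact: Ew0.
have hk0 : 0 < h k0 := functional_intK_gt0 h_ge0 hv Kk0.
have h_low w b : kappa w = UFin b -> 0 <= h (y0 - T w + b) + h k0.
  move=> kw; rewrite -linearD.
  have : E (0, y0 - T w + b + k0) by split=> //; exists w, b, k0.
  by move/hE; rewrite !linear0 add0r.
have hTc : continuous (h \o T).
  by move=> w; apply: continuous_comp; [exact: cT|exact: (functional_continuous K_cone K_int)].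
(* Dividing by [h k0] gives [h \o T'] the same values as [h \o T], so the bound carries over to
   [T']. *)
have [T' [cT' T'E]] := rank_one (f := h \o T : {linear W -> R^o}) ((h k0)^-1 *: k0) hTc.
have hT' w : h (T' w) = h (T w).
  by rewrite T'E /= !linearZ /= /GRing.scale /= mulVf ?mulr1 // lt0r_neq0.
exists T'; split.
  apply: (dom_conjugate_of_bound (f := h) (k0 := k0) (c := h y0 + h k0)) => // w b kw.
  by rewrite linearB /= hT'; have := h_low _ _ kw; rewrite linearD linearB /=; lra.
split=> // _ [p Pp <-]; rewrite T'E scalerA; suff hTp : 0 <= h (T p).
  have [r0|r0] := ltP 0 (h (T p) / h k0); first by apply: K_Z => //; exact: intK_K.
  have -> : h (T p) / h k0 = 0 by apply/eqP; rewrite eq_le r0 divr_ge0 // ltW.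
  by rewrite scale0r; exact: K_0.
(* Moving from [w0] to w0 - t p does not increase [kappa] and adds [t * h (T p)] to a quantity that
   stays bounded below. *)
apply: (@nonneg_slope _ (h (y0 - T w0 + b0) + h k0)) => t t0.
have [b' kb' Kb'] := kappa_shift (P_cone.1 _ _ t0 Pp) kw0.
have := h_low _ _ kb'; have := functional_K_ge0 K_cone K_int h_ge0 Kb'.
rewrite !(linearD, linearB, linearZ, linearN) /= /GRing.scale /=; lra.
Qed.

(** * Separation of the perturbed epigraph and strong duality *)

Lemma lin_combination (U : lmodType R) (B : set U) (c : R) (x y : U) :
  lin B x -> lin B y -> lin B (c *: x + y).
Proof.
move=> Bx By V [V_submod BV]; have xV := Bx V (conj V_submod BV).
have yV := By V (conj V_submod BV).
by apply/set_mem; apply: V_submod.2; rewrite inE.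
Qed.

(** Over a perturbation (u, z), the equations say H(x) + u = w - p and G(x) + z = - s. The shift [p]
    relaxes the composition to an inequality for [P], as the convexity of [H] requires; taking [k]
    in the interior makes every vertical section open. *)
Definition perturbed_epigraph (L : {linear X -> Y}) : set ((W * Z) * Y) :=
  [set e | exists x h g a w b p s k,
    [/\ C x, H x = UFin h, G x = UFin g & F x = UFin a] /\
    [/\ kappa w = UFin b, P p, S s, interior K k &
      e = ((w - h - p, - s - g), a - L x + b + k)]].

Lemma perturbed_epigraph_segment (L : {linear X -> Y}) (e e' : (W * Z) * Y) (t s : R) :
  perturbed_epigraph L e -> perturbed_epigraph L e' -> 0 < t -> 0 < s ->
  exists2 e2, perturbed_epigraph L e2 & t *: e + s *: e' = (t + s) *: e2.
Proof.
move=> [x [h [g [a [w [b [p [z [k [[Cx Hx Gx Fx] [kw Pp Sz Kk eE]]]]]]]]]]].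
move=> [x' [h' [g' [a' [w' [b' [p' [z' [k' [[Cx' Hx' Gx' Fx'] [kw' Pp' Sz' Kk' e'E]]]]]]]]]]].
move=> t0 s0; have K0 := K_0 K_closed K_cone K_int.
have [h2 [p2 [Hx2 Pp2 hE]]] := cone_convex_avg H_convex Hx Hx' Pp Pp' t0 s0.
have [g2 [z2 [Gx2 Sz2 gE]]] := cone_convex_avg G_convex Gx Gx' Sz Sz' t0 s0.
have [a2 [q [Fx2 Kq aE]]] := cone_convex_avg F_convex Fx Fx' K0 K0 t0 s0.
have [b2 [r [kw2 Kr bE]]] := cone_convex_avg kappa_convex kw kw' K0 K0 t0 s0.
have Kk2 : interior K (avg t s k k').
  apply: intK_Z; rewrite ?invr_gt0 ?addr_gt0 //.
  by apply: intK_D => //; exact: intK_Z.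
exists (avg t s e e'); last exact: scale_avg.
(* The slacks [q] and [r] in [K] left by the convexity of [F] and [kappa] are absorbed by the
   interior slack. *)
exists (avg t s x x'), h2, g2, a2, (avg t s w w'), b2, p2, z2, (avg t s k k' + (q + r)).
split; split=> //; first exact: convex_set_avg.
  by apply: intK_DK => //; exact: K_D.
have -> : avg t s w w' - h2 - p2 = avg t s w w' - (h2 + p2) by lmod.
have -> : - z2 - g2 = - (g2 + z2) by lmod.
have -> : a2 - L (avg t s x x') + b2 + (avg t s k k' + (q + r)) =
  (a2 + q) - L (avg t s x x') + (b2 + r) + avg t s k k' by lmod.
rewrite -hE -gE -aE -bE (linear_avg L) eE e'E /avg.
congr ((_, _), _); rewrite /=; lmod.
Qed.

Lemma strong_duality (L : {linear X -> Y}) (y0 : Y) :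
  (feasible S C G `&` udom F `&` H @^-1` (UFin @` udom kappa)) !=set0 ->
  (exists (y : Y) (V : set (W * Z)), nbhs (0 : W * Z) V /\
      forall (w : W) (z : Z), V (w, z) -> Z01 S C kappa H G (w, z) ->
        exists x, [/\ C x, (UFin @` setN S) (G x + UFin z)%U &
          cle K (F x + uapp kappa (H x + UFin w) + UFin (- L x))%U (UFin y)]) ->
  (forall m, primal_values S C F kappa H G L m -> ~ clt K m (BFin y0)) ->
  exists T1 T2, [/\ dom_conjugate K kappa T1, Lplus K P T1, Lplus K S T2 &
    forall x w, C x -> ~ clt K (u2b (lagrangian F kappa H G L T1 T2 x w)) (BFin y0)].
Proof.
move=> [x0 [[[Cx0 [_ [s0 Ss0 <-] Gx0]] Fx0] [h0 kh0 Hx0]]] [yL [V [V0 slater]]] y0_lb.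
move: Fx0 kh0; rewrite /udom /=.
case Fx0 : (F x0) => [a0|] // _; case kh0 : (kappa h0) => [b0|] // _.
have [k0 Kk0] := K_int; have [p0 Pp0] := P_nonempty.
pose E := perturbed_epigraph L.
have E0 p s k : P p -> S s -> interior K k ->
    E ((h0 - h0 - p, - s - - s0), a0 - L x0 + b0 + k).
  by move=> Pp Ss Kk; exists x0, h0, (- s0), a0, h0, b0, p, s, k.
(* [P] may not contain 0, so that points of [E] carry a nonzero shift along [P],
   which the neighborhood has to leave room for. *)
have [t0 t0_gt0 [A [A_convex A0 AV]]] : exists2 t0 : R, 0 < t0 & exists A : set (W * Z),
    [/\ convex_set A, nbhs (0 : W * Z) A & forall w z, A (w, z) -> V (w + t0 *: p0, z)].
  have := @add_continuous (W * Z)%type (0, 0) V; rewrite /= addr0 => /(_ V0).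
  move=> [[A1 A2] /= [A1_0 A2_0] A12].
  have [t0 t0_gt0 At0] := nbhs_line ((p0, 0) : W * Z) A2_0.
  have [B B_convex [B_open B_basis]] := @locally_convex R (W * Z)%type.
  have [A [BA A0] AA1] := B_basis 0 A1 A1_0.
  exists t0 => //; exists A; split.
  - by apply: B_convex; rewrite inE.
  - by apply: open_nbhs_nbhs; split=> //; exact: B_open.
  - move=> w z Awz.
    have -> : (w + t0 *: p0, z) = (w, z) + t0 *: (p0, 0).
      by apply: injective_projections; rewrite //= scaler0 addr0.
    apply: (A12 ((w, z), t0 *: (p0, 0))); split; first exact: AA1.
    have := At0 t0; rewrite add0r gtr0_norm // => /(_ (lexx _)).
    exact.
have Pt0 : P (t0 *: p0) by exact: P_cone.1.
have [||||v e c Av Ee vE|f [phi [f_cont phi_ge0 [y1 phi_y1] f_phi]]] :=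
  @separation R (W * Z)%type Y K K_cone E A y0 (yL + k0) _ (@perturbed_epigraph_segment L)
    _ _ _ A_convex A0.
- by eexists; exact: (E0 _ _ _ Pp0 Ss0 Kk0).
- move=> u y k [x [h [g [a [w [b [p [s [k' [Hxs [kw Pp Ss Kk' [-> ->]]]]]]]]]]]] Kk.
  exists x, h, g, a, w, b, p, s, (k' + k); split=> //; split=> //; first exact: intK_D.
  by rewrite addrA.
- move=> u y v [x [h [g [a [w [b [p [s [k [Hxs [kw Pp Ss Kk [-> ->]]]]]]]]]]]].
  have [d d0 Kd] := intK_line v Kk; exists d => // t td.
  exists x, h, g, a, w, b, p, s, (k + t *: v); split=> //; split=> //; first exact: Kd.
  by rewrite addrA.
(* A point of [E] over the zero perturbation has [h = w - p] and [g = - s]: [x] is feasible, and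
   since [kappa] does not increase from [w] to [h], its primal value is strictly below [y0]. *)
- move=> [x [h [g [a [w [b [p [s [k [[Cx Hx Gx Fx] [kw Pp Ss Kk [whp sg y0E]]]]]]]]]]]].
  have hE : h = w - p.
    by apply/eqP; rewrite -subr_eq0 -oppr_eq0 {1}whp; apply/eqP; lmod.
  have gE : g = - s by apply/eqP; rewrite -addr_eq0 addrC -oppr_eq0 opprD -sg.
  have [b' kh Kb] := kappa_shift Pp kw; rewrite -hE in kh.
  apply: (y0_lb (BFin (a + b' + - L x))).
    exists x; last by rewrite Fx Hx /= kh.
    by split=> //; exists g => //; exists s.
  rewrite clt_fin y0E.
  have -> : a - L x + b + k - (a + b' + - L x) = k + (b - b') by lmod.
  exact: intK_DK.
- case: Ee => [x [h [g [a [w [b [p [s [k [[Cx Hx Gx Fx] [kw Pp Ss Kk eE]]]]]]]]]]].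
  rewrite eE /= in vE; case: v vE Av => [v1 v2] vE /AV Vv.
  have gen w1 b1 : kappa w1 = UFin b1 -> Z01 S C kappa H G (h - w1, g + s).
    move=> kw1; apply: sub_gen_smallest.
    exists (h, g); first by exists x.
    by exists (- w1, s) => //; split=> //=; exists w1 => //; rewrite /udom /= kw1.
  have [b1 kb1 _] := kappa_shift Pp kw.
  have [b2 kb2 _] := kappa_shift Pt0 kw.
  (* [v] is a multiple of a generator, and the shift [(t0 *: p0, 0)] is a difference of two
     generators, [kappa] being finite at [w] and at [w - t0 *: p0]. *)
  have Zv : Z01 S C kappa H G (v1 + t0 *: p0, v2).
    have -> : (v1 + t0 *: p0, v2) = (- c) *: (h - (w - p), g + s) +
        (-1 *: (h - w, g + s) + (h - (w - t0 *: p0), g + s)).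
      by case: vE => -> ->; apply: injective_projections => /=; lmod.
    by do 2 (apply: lin_combination; first by apply: gen; eassumption); apply: gen; eassumption.
  have [x2 [Cx2]] := slater _ _ Vv Zv.
  case Gx2 : (G x2) => [g2|] /=; last by case.
  move=> [_ [s2 Ss2 <-] [s2E]].
  case Fx2 : (F x2) => [a2|] //; case Hx2 : (H x2) => [h2|] //=.
  case kw2 : (kappa _) => [c2|] //=; rewrite -/(cle K (UFin _) (UFin _)) cle_fin => KyL.
  (* Using [t0 *: p0] as the element of [P] cancels the shift added to [v1], and the interior slack
     lifts the height to exactly [yL + k0]. *)
  exists x2, h2, g2, a2, (h2 + (v1 + t0 *: p0)), c2, (t0 *: p0), s2.
  exists (k0 + (yL - (a2 + c2 + - L x2))); split=> //; split=> //.
    exact: intK_DK.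
  congr ((_, _), _); [by lmod| |by lmod].
  by rewrite s2E; lmod.
have phik0 : 0 < phi k0 := functional_intK_gt0 phi_ge0 phi_y1 Kk0.
(* The normalization [phi k1 = -1] makes [phi] composed with [T1] and [T2] equal to [- f1] and
   [- f2]. *)
pose k1 : Y := - ((phi k0)^-1 *: k0).
have phik1 : phi k1 = -1.
  by rewrite /k1 linearN linearZ /= /GRing.scale /= mulVf // lt0r_neq0.
have lin_f1 : linear ((fun w => f (w, 0)) : W -> R^o).
  move=> c u v; rewrite -linearP; congr (f _).
  by apply: injective_projections => //=; lmod.
have lin_f2 : linear ((fun z => f (0, z)) : Z -> R^o).
  move=> c u v; rewrite -linearP; congr (f _).
  by apply: injective_projections => //=; lmod.
have [f1 f1E] := bundle_linear lin_f1; have [f2 f2E] := bundle_linear lin_f2.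
have f12 w z : f (w, z) = f1 w + f2 z.
  rewrite f1E f2E -linearD; congr (f _).
  by apply: injective_projections => /=; lmod.
have f1_cont : continuous f1.
  rewrite (_ : (f1 : W -> R^o) = f \o (fun w => (w, 0))); last exact/funext.
  move=> w; apply: continuous_comp; last exact: f_cont.
  by apply: cvg_pair; [exact: cvg_id|exact: cvg_cst].
have f2_cont : continuous f2.
  rewrite (_ : (f2 : Z -> R^o) = f \o (fun z => (0, z))); last exact/funext.
  move=> z; apply: continuous_comp; last exact: f_cont.
  by apply: cvg_pair; [exact: cvg_cst|exact: cvg_id].
have [T1 [T1_cont T1E]] := rank_one k1 f1_cont.
have [T2 [T2_cont T2E]] := rank_one k1 f2_cont.
have phiT1 w : phi (T1 w) = - f1 w.
  by rewrite T1E linearZ /= phik1 /GRing.scale /= mulrN1.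
have phiT2 z : phi (T2 z) = - f2 z.
  by rewrite T2E linearZ /= phik1 /GRing.scale /= mulrN1.
(* The separation inequality in Lagrangian form, with the slacks [p], [s], [k] kept apart. Fixing
   [x0] bounds the conjugate at [T1]; letting [p] or [s] grow gives the signs on [P] and [S];
   letting all slacks shrink removes them, though 0 may lie outside [P] and [S]. *)
have key x h g a w b p s k : C x -> H x = UFin h -> G x = UFin g -> F x = UFin a ->
    kappa w = UFin b -> P p -> S s -> interior K k ->
    0 <= (phi (a - L x + T1 h + T2 g + b - T1 w) - phi y0) +
      (phi (T1 p) + phi (T2 s) + phi k).
  move=> Cx Hx Gx Fx kw Pp Ss Kk.
  have : E ((w - h - p, - s - g), a - L x + b + k).
    by exists x, h, g, a, w, b, p, s, k.
  move/f_phi; rewrite f12 !(linearD, linearN) /= !(phiT1, phiT2); lra.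
have multiplier_K (r : R) : 0 <= - r -> K (r *: k1).
  rewrite /k1 scalerN -scaleNr scalerA le_eqVlt => /predU1P[<-|r0].
    by rewrite mul0r scale0r; exact: K_0.
  by apply: K_Z; [exact: K_cone|rewrite divr_gt0|exact: intK_K].
exists T1, T2; split.
- apply: (dom_conjugate_of_bound phi_ge0 phik0 T1_cont
    (c := phi (a0 - L x0 + T1 h0 + T2 (- s0)) - phi y0 + (phi (T1 p0) + phi (T2 s0) + phi k0))).
  move=> w b kw; have := key _ _ _ _ _ _ _ _ _ Cx0 (esym Hx0) (esym Gx0) Fx0 kw Pp0 Ss0 Kk0.
  by rewrite !(linearD, linearN) /=; lra.
- split=> // _ [p Pp <-]; rewrite T1E; apply: multiplier_K; rewrite -phiT1.
  apply: (@nonneg_slope _ (phi (a0 - L x0 + T1 h0 + T2 (- s0) + b0 - T1 h0) - phi y0 +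
    (phi (T2 s0) + phi k0))) => t t_gt0.
  have := key _ _ _ _ _ _ _ _ _ Cx0 (esym Hx0) (esym Gx0) Fx0 kh0 (P_cone.1 _ _ t_gt0 Pp) Ss0 Kk0.
  by rewrite !linearZ /= /GRing.scale /=; lra.
- split=> // _ [s Ss <-]; rewrite T2E; apply: multiplier_K; rewrite -phiT2.
  apply: (@nonneg_slope _ (phi (a0 - L x0 + T1 h0 + T2 (- s0) + b0 - T1 h0) - phi y0 +
    (phi (T1 p0) + phi k0))) => t t_gt0.
  have := key _ _ _ _ _ _ _ _ _ Cx0 (esym Hx0) (esym Gx0) Fx0 kh0 Pp0 (S_cone.1 _ _ t_gt0 Ss) Kk0.
  by rewrite !linearZ /= /GRing.scale /=; lra.
- move=> x w Cx; rewrite /lagrangian.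
  case Fx : (F x) => [a|] //=; case Hx : (H x) => [h|] //=.
  case Gx : (G x) => [g|] //=; case kw : (kappa w) => [b|] //=.
  rewrite -/(clt K (BFin _) (BFin _)) clt_fin => Kn.
  have := functional_intK_gt0 phi_ge0 phi_y1 Kn.
  suff : 0 <= phi (a - L x + T1 h + T2 g + b - T1 w) - phi y0.
    by rewrite linearB /=; lra.
  apply: (@nonneg_limit _ _ (phi (T1 p0) + phi (T2 s0) + phi k0)) => t t_gt0.
  have := key _ _ _ _ _ _ _ _ _ Cx Hx Gx Fx kw (P_cone.1 _ _ t_gt0 Pp0)
    (S_cone.1 _ _ t_gt0 Ss0) (intK_Z K_cone t_gt0 Kk0).
  by rewrite !linearZ /= /GRing.scale /=; lra.
Qed.

(** At a feasible [x], choose [w] equal to H(x) and [s] equal to - G(x): both multiplier terms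
    cancel and the primal value remains. *)
Lemma weak_duality (L : {linear X -> Y}) (T1 : {linear W -> Y}) (T2 : {linear Z -> Y})
    (m u : bext Y) : primal_values S C F kappa H G L m -> clt K m u ->
  exists x w s y, [/\ C x, S s, lagrangian F kappa H G L T1 T2 x w = UFin y &
    clt K (BFin (y + T2 s)) u].
Proof.
move=> [x [Cx [_ [s Ss <-] Gx]] <-].
case Fx : (F x) => [a|] //=; case Hx : (H x) => [h|] //=.
case kh : (kappa h) => [b|] //= mu; exists x, h, s.
exists (a + - L x + T1 h + T2 (- s) + b + - T1 h).
split=> //; first by rewrite /lagrangian Fx Hx -Gx kh.
have -> : a + - L x + T1 h + T2 (- s) + b + - T1 h + T2 s = a + b + - L x.
  by rewrite linearN; lmod.
exact: mu.
Qed.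

Definition loose_lagrangian_values (L : {linear X -> Y}) : set (set (bext Y)) :=
  [set N | exists T1 T2, [/\ (dom_conjugate K kappa `&` Lplus K P) T1, Lplus K S T2 &
    N = [set m | exists x w, C x /\ m = u2b (lagrangian F kappa H G L T1 T2 x w)]]].

Definition lagrangian_values (L : {linear X -> Y}) : set (set (bext Y)) :=
  [set N | exists T1 T2, [/\ dom_conjugate K kappa T1, Lplusw K S T2 &
    N = [set m | exists x w s, [/\ C x, S s &
      m = u2b (lagrangian F kappa H G L T1 T2 x w + UFin (T2 s))%U]]]].

Lemma Lplus_Lplusw (T : {linear Z -> Y}) : Lplus K S T -> Lplusw K S T.
Proof.
move=> [cT TK]; split=> //; rewrite -subset0 => y [Ty [k Kk ky]].
apply: (intK_not_opp K_proper K_cone (TK _ Ty)).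
by rewrite -ky opprK.
Qed.

Lemma Lplus_zero : exists T : {linear Z -> Y}, Lplus K S T.
Proof.
have lin0 : linear (fun _ : Z => 0 : Y) by move=> c u v; rewrite scaler0 addr0.
have [T TE] := bundle_linear lin0; exists T; split.
  by rewrite (_ : (T : Z -> Y) = fun=> 0); [exact: cst_continuous|exact/funext].
by move=> _ [z _ <-]; rewrite TE; exact: K_0.
Qed.

(** * The two stable duality equalities *)

Section StableDuality.
Variable L : {linear X -> Y}.
Hypothesis feasible_dom :
  (feasible S C G `&` udom F `&` H @^-1` (UFin @` udom kappa)) !=set0.
Hypothesis regularity :
  exists (y : Y) (V : set (W * Z)), nbhs (0 : W * Z) V /\
    forall (w : W) (z : Z), V (w, z) -> Z01 S C kappa H G (w, z) ->
      exists x, [/\ C x, (UFin @` setN S) (G x + UFin z)%U &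
        cle K (F x + uapp kappa (H x + UFin w) + UFin (- L x))%U (UFin y)].
Hypothesis dom_conjugate_nonempty : dom_conjugate K kappa !=set0.

Lemma primal_finite : exists m0, primal_values S C F kappa H G L (BFin m0).
Proof.
have [x [[[Cx Gx] Fx] [h kh Hx]]] := feasible_dom.
move: Fx kh; rewrite /udom /=; case Fx : (F x) => [a|] // _.
case kh : (kappa h) => [b|] // _; exists (a + b - L x); exists x; first by split.
by rewrite Fx -Hx /= kh.
Qed.

Lemma loose_stable_strong_duality :
  WInf K (primal_values S C F kappa H G L) = WMax K (DLplus K P S C F kappa H G L).
Proof.
have [m0 Mm0] := primal_finite.
apply: (WInf_eq_WMax K_closed K_cone K_int (NN := loose_lagrangian_values L) _ Mm0).
- move=> d; split=> [[T1 T1P [T2 T2S Nd]]|[_ [T1 [T2 [T1P T2S ->]]] Nd]].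
    by eexists; first by exists T1, T2.
  by exists T1 => //; exists T2.
- have [T1 T1P] := dom_conjugate_Lplus_nonempty dom_conjugate_nonempty.
  by have [T2 T2S] := Lplus_zero; eexists; exists T1, T2.
- move=> _ m u [T1 [T2 [T1P [cT2 T2S] ->]]] Mm mu.
  have [x [w [s [y [Cx Ss lE yu]]]]] := weak_duality T1 T2 Mm mu.
  exists (BFin y); first by exists x, w; rewrite lE.
  (* The loose Lagrangian omits [T2 s]; as this lies in [K], the value [y] is below [y + T2 s]. *)
  apply: (clt_lower K_cone) yu; rewrite addrAC subrr add0r.
  by apply: T2S; exists s.
- move=> b /WInfP[b_lb _].
  have [T1 [T2 [domT1 T1P T2S T_lb]]] := strong_duality feasible_dom regularity b_lb.
  eexists; first by exists T1, T2.
  by move=> _ [x [w [Cx ->]]]; exact: T_lb.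
Qed.

(** The pair found for the loose dual also serves here: its [T2] maps [S] into [K], so adding [T2 s]
    only raises the Lagrangian values. *)
Lemma stable_strong_duality :
  WInf K (primal_values S C F kappa H G L) = WMax K (DL K S C F kappa H G L).
Proof.
have [m0 Mm0] := primal_finite.
apply: (WInf_eq_WMax K_closed K_cone K_int (NN := lagrangian_values L) _ Mm0).
- move=> d; split=> [[T1 T1P [T2 T2S Nd]]|[_ [T1 [T2 [T1P T2S ->]]] Nd]].
    by eexists; first by exists T1, T2.
  by exists T1 => //; exists T2.
- have [T1 T1P] := dom_conjugate_nonempty.
  have [T2 /Lplus_Lplusw T2S] := Lplus_zero.
  by eexists; exists T1, T2.
- move=> _ m u [T1 [T2 [T1P T2S ->]]] Mm mu.
  have [x [w [s [y [Cx Ss lE yu]]]]] := weak_duality T1 T2 Mm mu.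
  by exists (BFin (y + T2 s)) => //; exists x, w, s; rewrite lE.
- move=> b /WInfP[b_lb _].
  have [T1 [T2 [domT1 T1P T2S T_lb]]] := strong_duality feasible_dom regularity b_lb.
  eexists; first by exists T1, T2; split=> //; exact: Lplus_Lplusw.
  move=> _ [x [w [s [Cx Ss ->]]]]; have := T_lb x w Cx.
  case: (lagrangian _ _ _ _ _ _ _ _ _) => [y|] //=; apply: contra_not.
  rewrite -/(clt K (BFin _) (BFin _)); apply: (clt_lower K_cone).
  by rewrite addrAC subrr add0r; apply: T2S.2; exists s.
Qed.

End StableDuality.
End Composite.

Unset Implicit Arguments.

Theorem corollary5p2 (R : realType) (X Y Z W : tvsType R)
  (hausX : hausdorff_space X) (hausY : hausdorff_space Y)
  (hausZ : hausdorff_space Z) (hausW : hausdorff_space W)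
  (K : set Y) (P : set W) (S : set Z) (C : set X)
  (K_proper : K <> setT) (K_closed : closed K) (K_cone : convex_cone K)
  (K_int : interior K !=set0)
  (P_nonempty : P !=set0) (P_cone : convex_cone P)
  (S_nonempty : S !=set0) (S_cone : convex_cone S)
  (F : X -> uext Y) (kappa : W -> uext Y) (H : X -> uext W) (G : X -> uext Z)
  (F_proper : uproper F) (kappa_proper : uproper kappa)
  (H_proper : uproper H) (G_proper : uproper G)
  (C_nonempty : C !=set0)
  (feasible_dom :
    feasible S C G `&` udom F `&` H @^-1` (UFin @` udom kappa) !=set0)
  (F_convex : cone_convex K F) (H_convex : cone_convex P H)
  (G_convex : cone_convex S G) (kappa_convex : cone_convex K kappa)
  (kappa_nondecreasing : nondecreasing_cone K P kappa)
  (C_convex : convex_set C)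
  (regularity : forall L : {linear X -> Y}, continuous L ->
    exists (y : Y) (V : set (W * Z)), nbhs (0 : W * Z) V /\
      forall (w : W) (z : Z), V (w, z) -> Z01 S C kappa H G (w, z) ->
        exists x, [/\ C x, (UFin @` setN S) (G x + z%:fin)%U &
          cle K (F x + uapp kappa (H x + w%:fin) + (- L x)%:fin)%U y%:fin])
  (dom_conjugate_nonempty : dom_conjugate K kappa !=set0) :
  forall L : {linear X -> Y}, continuous L ->
    WInf K (primal_values S C F kappa H G L) = WMax K (DL K S C F kappa H G L)
    /\ WMax K (DL K S C F kappa H G L) = WMax K (DLplus K P S C F kappa H G L).
Proof.
move=> L cL; have reg := regularity L cL.
have dual := stable_strong_duality K_proper K_closed K_cone K_int P_nonempty P_cone
  S_cone F_convex H_convex G_convex kappa_convex kappa_nondecreasing C_convex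
  feasible_dom reg dom_conjugate_nonempty.
have loose_dual := loose_stable_strong_duality K_closed K_cone K_int P_nonempty
  P_cone S_cone kappa_proper F_convex H_convex G_convex kappa_convex
  kappa_nondecreasing C_convex feasible_dom reg dom_conjugate_nonempty.
by split=> //; rewrite -dual.
Qed.
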